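(* The Simple Binary Linear formulation (SB-L) is not pairwise-ideal in general: there exist problem data for two rectangular objects $i,j$ (region dimensions, object dimensions and clearances, as described in the context) such that the continuous relaxation of (SB-L) for the pair $(i,j)$ has an extreme point $(\mathbf{c},\delta_{ij},\delta_{ji})\in\mathbb{R}^4\times\mathbb{R}^2$ with $(\delta_{ij},\delta_{ji})\notin\{0,1\}^2$.
   Context: Parameters. The region has dimensions $W_x\times W_y$. Each object $k\in\{i,j\}$ has dimensions $w_{ks}>0$ and clearances $\sigma^-_{ks},\sigma^+_{ks}\ge 0$ for $s\in\{x,y\}$. Put $\mathscr{F}_{ij}=\{(i,j,x),(j,i,x),(i,j,y),(j,i,y)\}$, $\mathrm{LB}_{ks}=\tfrac12 w_{ks}+\sigma^-_{ks}$, $\mathrm{UB}_{ks}=W_s-\tfrac12 w_{ks}-\sigma^+_{ks}$ and $\mathrm{P}_{kls}=\tfrac12 w_{ks}+\tfrac12 w_{ls}+\max\{\sigma^+_{ks},\sigma^-_{ls}\}$. Formulation (SB-L) for the pair $(i,j)$. Continuous variables $c_{ix},c_{jx},c_{iy},c_{jy}$ and binary variables $\delta_{ij},\delta_{ji}$. Define the affine functions $$H_{ijx}=\delta_{ij}+\delta_{ji},\quad H_{ijy}=1-\delta_{ij}+\delta_{ji},\quad H_{jix}=2-\delta_{ij}-\delta_{ji},\quad H_{jiy}=1+\delta_{ij}-\delta_{ji}$$ (that is, $H_{kls}=\|\bar{\boldsymbol\delta}_{kls}-(\delta_{ij},\delta_{ji})\|_1$ for the codes $\bar{\boldsymbol\delta}_{ijx}=(0,0)$,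 $\bar{\boldsymbol\delta}_{ijy}=(1,0)$, $\bar{\boldsymbol\delta}_{jix}=(1,1)$, $\bar{\boldsymbol\delta}_{jiy}=(0,1)$). The constraints are, for all $(k,l,s)\in\mathscr{F}_{ij}$: $$c_{ls}\ge \mathrm{LB}_{ks}+\mathrm{P}_{kls}-(\mathrm{LB}_{ks}+\mathrm{P}_{kls}-\mathrm{LB}_{ls})H_{kls},$$ $$c_{ks}\le \mathrm{UB}_{ls}-\mathrm{P}_{kls}-(\mathrm{UB}_{ls}-\mathrm{P}_{kls}-\mathrm{UB}_{ks})H_{kls},$$ $$c_{ls}-c_{ks}\ge \mathrm{P}_{kls}+(\mathrm{LB}_{ls}-\mathrm{P}_{kls}-\mathrm{UB}_{ks})H_{kls},$$ $$\mathrm{LB}_{ks}\le c_{ks}\le\mathrm{UB}_{ks},$$ together with $(\delta_{ij},\delta_{ji})\in\{0,1\}^2$. The continuous relaxation replaces $(\delta_{ij},\delta_{ji})\in\{0,1\}^2$ by $(\delta_{ij},\delta_{ji})\in[0,1]^2$. A mixed-integer program is ideal if every extreme point of its continuous relaxation takes integer values in all integer variables; a packing formulation is pairwise-ideal if it is ideal when restricted to two objects. *)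

(* Defs.v *)
From HB Require Import structures.
From mathcomp Require Import all_boot all_order all_algebra.
From mathcomp Require Import classical_sets reals.

Set Implicit Arguments.
Unset Strict Implicit.
Unset Printing Implicit Defensive.

Import Order.TTheory GRing.Theory Num.Theory.

Local Open Scope classical_set_scope.
Local Open Scope ring_scope.

Definition extreme_point (R : realType) (E : lmodType R) (A : set E) (x : E) :
    Prop :=
  A x /\
  forall (y z : E) (t : R), A y -> A z -> 0 < t < 1 ->
    x = t *: y + (1 - t) *: z -> y = x /\ z = x.

(* A mixed-integer program whose integer variables are all binary.  Only its
   feasible region matters for idealness, so there is no objective; [mbp_rows]
   is the set cut out by all constraints other than the 0-1 requirement on
   the [m] binary variables, [C] being the space of continuous variables. *)
Record mbp (R : realType) (C : lmodType R) (m : nat) : Type := Mbp {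
  mbp_rows : set (C * 'rV[R]_m)%type
}.

Definition mbp_feasible (R : realType) (C : lmodType R) (m : nat)
    (M : mbp C m) : set (C * 'rV[R]_m)%type :=
  [set x | mbp_rows M x /\ forall a, x.2 0 a = 0 \/ x.2 0 a = 1].

Definition mbp_relaxation (R : realType) (C : lmodType R) (m : nat)
    (M : mbp C m) : set (C * 'rV[R]_m)%type :=
  [set x | mbp_rows M x /\ forall a, 0 <= x.2 0 a <= 1].

Definition ideal (R : realType) (C : lmodType R) (m : nat) (M : mbp C m) :
    Prop :=
  forall x, extreme_point (mbp_relaxation M) x ->
    forall a, x.2 0 a \is a Num.int.

(* Objects and axes are both indexed by ['I_2]. *)
Definition obj_i : 'I_2 := ord0.
Definition obj_j : 'I_2 := ord_max.
Definition axis_x : 'I_2 := ord0.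
Definition axis_y : 'I_2 := ord_max.

Record packing_data (R : realType) : Type := PackingData {
  region : 'I_2 -> R;                 (* W_s *)
  dims : 'I_2 -> 'I_2 -> R;           (* w_ks *)
  clear_minus : 'I_2 -> 'I_2 -> R;    (* sigma^-_ks *)
  clear_plus : 'I_2 -> 'I_2 -> R      (* sigma^+_ks *)
}.

Definition valid_data (R : realType) (D : packing_data R) : Prop :=
  (forall s, 0 < region D s) /\
  (forall k s, [/\ 0 < dims D k s, 0 <= clear_minus D k s
                 & 0 <= clear_plus D k s]).

Definition LB (R : realType) (D : packing_data R) (k s : 'I_2) : R :=
  dims D k s / 2 + clear_minus D k s.

Definition UB (R : realType) (D : packing_data R) (k s : 'I_2) : R :=
  region D s - dims D k s / 2 - clear_plus D k s.

Definition Psep (R : realType) (D : packing_data R) (k l s : 'I_2) : R :=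
  dims D k s / 2 + dims D l s / 2
  + Num.max (clear_plus D k s) (clear_minus D l s).

Definition precedences : seq ('I_2 * 'I_2 * 'I_2) :=
  [:: (obj_i, obj_j, axis_x); (obj_j, obj_i, axis_x);
      (obj_i, obj_j, axis_y); (obj_j, obj_i, axis_y)].

(* Entry 0 of the binary vector is delta_ij, entry 1 is delta_ji. *)
Definition delta_ij (R : realType) (d : 'rV[R]_2) : R := d 0 ord0.
Definition delta_ji (R : realType) (d : 'rV[R]_2) : R := d 0 ord_max.

(* On [0,1]^2 this is the l1 distance from [d] to the code of the triple
   (k,l,s): (0,0) for (i,j,x), (1,0) for (i,j,y), (1,1) for (j,i,x) and (0,1)
   for (j,i,y).  As [l] is the other object, it is not an argument. *)
Definition Hcode (R : realType) (d : 'rV[R]_2) (k s : 'I_2) : R :=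
  if k == obj_i then
    if s == axis_x then delta_ij d + delta_ji d
    else 1 - delta_ij d + delta_ji d
  else
    if s == axis_x then 2 - delta_ij d - delta_ji d
    else 1 + delta_ij d - delta_ji d.

(* [c k s] is the coordinate of the centre of object [k] along axis [s]. *)
Definition sbl_rows (R : realType) (D : packing_data R) :
    set ('M[R]_(2, 2) * 'rV[R]_2)%type :=
  [set x : 'M[R]_(2, 2) * 'rV[R]_2 |
    let c : 'M[R]_(2, 2) := x.1 in
    let d : 'rV[R]_2 := x.2 in
    forall k l s : 'I_2, (k, l, s) \in precedences ->
    [/\ c l s >= LB D k s + Psep D k l s
                 - (LB D k s + Psep D k l s - LB D l s) * Hcode d k s,
        c k s <= UB D l s - Psep D k l s
                 - (UB D l s - Psep D k l s - UB D k s) * Hcode d k s,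
        c l s - c k s >= Psep D k l s
                 + (LB D l s - Psep D k l s - UB D k s) * Hcode d k s
      & LB D k s <= c k s <= UB D k s]].

Definition SBL (R : realType) (D : packing_data R) : mbp 'M[R]_(2, 2) 2 :=
  Mbp (@sbl_rows R D).

(* A packing formulation enters only through its restriction to two objects. *)
Definition pairwise_ideal (R : realType) (C : lmodType R) (m : nat)
    (F : packing_data R -> mbp C m) : Prop :=
  forall D, valid_data D -> ideal (F D).

(* Main.v *)
(** Consider two squares of side 2 without clearances in a square region of
    side 6, both placed in the lower left corner, so that every centre
    coordinate attains its lower bound LB = 1.  There the constraints
    [c l s >= 3 - 2 H_kls] say that all four H_kls are at least 1, while
    H_ijx + H_jix = H_ijy + H_jiy = 2.  Hence all H_kls equal 1, which forces
    delta_ij = delta_ji = 1/2: the face c = LB of the relaxation is a single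
    fractional point, which is therefore extreme. *)
Require Import Defs.
From mathcomp Require Import all_boot all_order all_algebra.
From mathcomp Require Import classical_sets reals.
From mathcomp Require Import zify lra.

Import Order.TTheory GRing.Theory Num.Theory.
Local Open Scope ring_scope.

(** The weighted excesses [t * (a - m)] and [(1 - t) * (b - m)] are nonnegative and sum to zero, so
    both vanish. *)
Lemma convex_comb_lb_eq (R : realFieldType) (m t a b : R) :
  0 < t < 1 -> m <= a -> m <= b -> m = t * a + (1 - t) * b -> a = m /\ b = m.
Proof.
move=> /andP[t0 t1] ma mb e.
have ta : 0 <= t * (a - m) by rewrite mulr_ge0 ?subr_ge0 // ltW.
have tb : 0 <= (1 - t) * (b - m) by rewrite mulr_ge0 ?subr_ge0 // ltW.
have za : t * (a - m) = 0 by lra.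
have zb : (1 - t) * (b - m) = 0 by lra.
split; apply/eqP; rewrite -subr_eq0.
  by move/eqP: za; rewrite mulf_eq0 gt_eqF.
by move/eqP: zb; rewrite mulf_eq0 gt_eqF ?subr_gt0.
Qed.

Lemma ord2_cases (k : 'I_2) : k = ord0 \/ k = ord_max.
Proof.
by case: k => [[|[|n]] hn] //; [left | right]; apply: val_inj.
Qed.

Section CornerVertex.
Variable R : realType.

Definition corner_data : packing_data R :=
  PackingData (fun=> 6) (fun _ _ => 2) (fun _ _ => 0) (fun _ _ => 0).

Definition corner_centres : 'M[R]_(2, 2) := const_mx 1.

Definition half_codes : 'rV[R]_2 := const_mx (1 / 2).

Lemma corner_data_valid : valid_data corner_data.
Proof. by split=> [s|k s]; [|split]; rewrite /= ?ler0n ?ltr0n. Qed.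

Lemma corner_LB k s : LB corner_data k s = 1.
Proof. by rewrite /LB /=; lra. Qed.

Lemma corner_UB k s : UB corner_data k s = 5.
Proof. by rewrite /UB /=; lra. Qed.

Lemma corner_Psep k l s : Psep corner_data k l s = 2.
Proof. by rewrite /Psep /= maxxx; lra. Qed.

Let relax := mbp_relaxation (SBL corner_data).

(** The centre of the unit square is at l1 distance 1 from each of its four vertices, which are the
    codes. *)
Lemma half_codes_Hcode k s : Hcode half_codes k s = 1.
Proof.
by rewrite /Hcode /delta_ij /delta_ji !mxE; case: ifP; case: ifP => _ _; lra.
Qed.

(** Where every [Hcode] is 1, the terms in [Psep] cancel: the rows collapse to the variable bounds
    and to [c l s - c k s >= LB - UB = -4]. *)
Lemma corner_vertex_relax : relax (corner_centres, half_codes).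
Proof.
split=> [c d k l s _|a]; last by rewrite mxE; lra.
rewrite /c /d half_codes_Hcode !corner_LB !corner_UB !corner_Psep !mxE.
by split; lra.
Qed.

Lemma relax_centre_ge1 x k s : relax x -> 1 <= x.1 k s.
Proof.
(* The bounds on [c k s] are stated only within the rows of a precedence with [k] first; [rev_ord k]
   is the other object. *)
case=> rows _; have prec : (k, rev_ord k, s) \in precedences.
  by case: (ord2_cases k) => ->; case: (ord2_cases s) => ->.
by case: (rows _ _ _ prec) => _ _ _ /andP[+ _]; rewrite corner_LB.
Qed.

Lemma relax_corner_codes x :
  relax x -> x.1 = corner_centres -> x.2 = half_codes.
Proof.
case: x => c d /= [rows _] ec.
have H_ge1 k l s : (k, l, s) \in precedences -> 1 <= Hcode d k s.
  move=> prec; have [+ _ _ _] := rows _ _ _ prec.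
  by rewrite /= ec !corner_LB corner_Psep mxE; lra.
have Hijx := H_ge1 obj_i obj_j axis_x isT.
have Hjix := H_ge1 obj_j obj_i axis_x isT.
have Hijy := H_ge1 obj_i obj_j axis_y isT.
have Hjiy := H_ge1 obj_j obj_i axis_y isT.
rewrite /Hcode /delta_ij /delta_ji /= in Hijx Hjix Hijy Hjiy.
(* The two x-inequalities give [delta_ij + delta_ji = 1], the two y-inequalities
   [delta_ij = delta_ji]. *)
apply/rowP => a; rewrite mxE.
by case: (ord2_cases a) => ->; lra.
Qed.

Lemma corner_vertex_extreme : extreme_point relax (corner_centres, half_codes).
Proof.
split=> [|y z t Ay Az t01 e]; first exact: corner_vertex_relax.
(* Each centre coordinate is at its lower bound, so [y] and [z] must lie in the same face. *)
have centre k s : y.1 k s = 1 /\ z.1 k s = 1.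
  apply: (@convex_comb_lb_eq _ _ t) => //; try exact: relax_centre_ge1.
  by have /(congr1 (fun x : 'M[R]_(2, 2) * 'rV[R]_2 => x.1 k s))
    := e; rewrite /= !mxE.
have ey : y.1 = corner_centres.
  by apply/matrixP => k s; rewrite mxE; case: (centre k s).
have ez : z.1 = corner_centres.
  by apply/matrixP => k s; rewrite mxE; case: (centre k s).
split; apply: injective_projections => //; exact: relax_corner_codes.
Qed.

Lemma half_not_int : (1 / 2 : R) \isn't a Num.int.
Proof.
apply/negP => /intrP[n e].
(* Doubling moves the equation to the integers, where parity refutes it. *)
have /eqP : (2 * n)%:~R = 1 :> R by rewrite intrM -e; lra.
by rewrite (eqr_int _ _ 1) => /eqP; lia.
Qed.

End CornerVertex.

Theorem theorem3 (R : realType) :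
  ~ pairwise_ideal (@SBL R) /\
  exists D : packing_data R, valid_data D /\
  exists (c : 'M[R]_(2, 2)) (d : 'rV[R]_2),
    extreme_point (mbp_relaxation (SBL D)) (c, d) /\
    ~ ((delta_ij d = 0 \/ delta_ij d = 1) /\
       (delta_ji d = 0 \/ delta_ji d = 1)).
Proof.
split.
  move=> /(_ _ (corner_data_valid R) _ (corner_vertex_extreme R) ord0).
  by rewrite /= mxE; apply/negP/half_not_int.
exists (corner_data R); split; first exact: corner_data_valid.
exists (corner_centres R), (half_codes R).
split; first exact: corner_vertex_extreme.
by rewrite /delta_ij mxE => -[[] ? _]; lra.
Qed.
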